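(* Let $F$ be a field of characteristic $p>0$, let $G$ be a locally pro-$p$ group, and let $C$ be a closed subgroup of the center of $G$. Suppose $(G,K)$ is $C$-fair for some open subgroup $K\subset G$ which is pro-$p$ in the induced topology. Then for every continuous character $\chi:C\to F^\times$ there are no nonzero projective objects in the category $\mathrm{Mod}_F^\chi(G)$.
   Context: A topological group is locally pro-$p$ if it has an open subgroup which is pro-$p$ in the induced topology. $F^\times$ carries the discrete topology. A representation of $G$ on an $F$-vector space is smooth if every vector has open stabilizer. $\mathrm{Mod}_F^\chi(G)$ is the abelian category of smooth $G$-representations on $F$-vector spaces on which $C$ acts via the character $\chi$ (morphisms are $G$-equivariant $F$-linear maps); projective means projective in this category. Definition ($C$-fair): for an open pro-$p$ subgroup $K\subset G$ and a closed central subgroup $C\subset G$, the pair $(G,K)$ is $C$-fair if for every open subgroup $H\subset K$ there is an open subgroup $H'\subset K$ such that for all $g\in G$ one has a strict inclusion $K\cap gH'Cg^{-1}\subsetneq K\cap gHCg^{-1}$. *)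

(* Defs.v *)
From HB Require Import structures.
From mathcomp Require Import all_boot all_order all_algebra.
From mathcomp Require Import all_classical topology.

Set Implicit Arguments.
Unset Strict Implicit.
Unset Printing Implicit Defensive.

Import GRing.Theory.
Local Open Scope classical_set_scope.
Local Open Scope ring_scope.

HB.mixin Record isTopologicalGroup G of Topological G & Group G := {
  mulg_continuous : continuous (fun z : G * G => (z.1 * z.2)%g);
  invg_continuous : continuous (fun x : G => (x^-1)%g)
}.

#[short(type="topologicalGroupType")]
HB.structure Definition TopologicalGroup :=
  {G of Topological G & Group G & isTopologicalGroup G}.

Section Groups.
Local Open Scope group_scope.
Variable G : topologicalGroupType.
Implicit Types (A B C H K N : set G) (g : G).

Definition is_subgroup H : Prop := group_closed [in H].

Definition is_normal_subgroup N K : Prop :=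
  [/\ is_subgroup N, N `<=` K & forall n k, N n -> K k -> N (n ^ k)].

Definition is_central C : Prop := forall c g, C c -> commute c g.

Definition mul_set A B : set G := [set a * b | a in A & b in B].

Definition conj_set g A : set G := [set g * a * g^-1 | a in A].

Definition cosets K N : set (set G) := [set mul_set [set k] N | k in K].

(* Openness relative to K is openness in [subspace K]: this type carries the
   topology on G for which the points outside K are isolated and which induces
   on K the same topology as G. *)
Definition open_in K N : Prop := open (N : set (subspace K)).

(* K is a compact Hausdorff group (for the induced topology) whose open
   subgroups form a base of neighbourhoods of the identity. *)
Definition profinite K : Prop :=
  [/\ is_subgroup K, compact K, hausdorff_space (subspace K)
    & forall U : set (subspace K), nbhs (1 : subspace K) U ->
      exists N, [/\ is_subgroup N, N `<=` K, open_in K N & N `<=` U]].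

Definition pro_p (p : nat) K : Prop :=
  profinite K /\
  forall N, is_normal_subgroup N K -> open_in K N ->
    exists n : nat, (cosets K N #= `I_(p ^ n)%N)%card.

Definition locally_pro_p (p : nat) : Prop := exists K, open K /\ pro_p p K.

Definition fair C K : Prop :=
  forall H, is_subgroup H -> open H -> H `<=` K ->
  exists H', [/\ is_subgroup H', open H', H' `<=` K
    & forall g, K `&` conj_set g (mul_set H' C) `<`
                K `&` conj_set g (mul_set H C)].

End Groups.

Section Representations.
Variables (F : fieldType) (G : topologicalGroupType).

(* A character of C with values in the multiplicative group of F is encoded by
   a function on G, of which only the restriction to C is relevant. *)
Definition continuous_character (C : set G) (chi : G -> F) : Prop :=
  [/\ forall c, C c -> chi c != 0,
      forall c d, C c -> C d -> chi (c * d)%g = chi c * chi d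
    & {within C, continuous (chi : G -> discrete_topology F)}].

Variables (C : set G) (chi : G -> F).

Record smooth_rep := SmoothRep {
  rep_space :> lmodType F;
  rep_act : G -> {linear rep_space -> rep_space};
  rep_act1 : forall v, rep_act 1%g v = v;
  rep_actM : forall g h v, rep_act (g * h)%g v = rep_act g (rep_act h v);
  rep_smooth : forall v, open [set g | rep_act g v = v];
  rep_central : forall c v, C c -> rep_act c v = chi c *: v
}.

Record rep_hom (X Y : smooth_rep) := RepHom {
  rep_fun :> {linear X -> Y};
  rep_equivariant : forall g x, rep_fun (rep_act X g x) = rep_act Y g (rep_fun x)
}.

Definition epimorphism (X Y : smooth_rep) (e : rep_hom X Y) : Prop :=
  forall (Z : smooth_rep) (u v : rep_hom Y Z), u \o e =1 v \o e -> u =1 v.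

Definition projective (P : smooth_rep) : Prop :=
  forall (X Y : smooth_rep) (e : rep_hom X Y) (f : rep_hom P Y),
    epimorphism e -> exists h : rep_hom P X, e \o h =1 f.

End Representations.

(* Main.v *)
(* Let P be projective.  For an open subgroup H of K, fairness provides an open
   subgroup H' of H such that K meets every gHCg^-1 in strictly more than it
   meets gH'Cg^-1.  Let X be the space of finitely supported families of
   vectors f(H, gH'C) of P, indexed by all H and all cosets of H'C, such that
   f(H, gH'C) is fixed by gHg^-1.  Summation is an epimorphism X -> P, since a
   vector fixed by H is the sum of a family supported at (H, H'C), so it has a
   section.  But it kills X^K: the stabilizer of gHC in K acts without fixed
   points on the cosets of H'C contained in gHC, by fairness, and as a pro-p
   group it fixes every vector that C and gHg^-1 act on by scalars, so the sum
   splits into constant sums over index sets of size divisible by p.  Hence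
   P^K = 0, and P = 0 because K is pro-p and F has characteristic p. *)

From HB Require Import structures.
Require Import Defs.
From mathcomp Require Import all_boot all_order all_algebra.
From mathcomp Require Import fingroup perm action pgroup sylow cyclic finmap.
From mathcomp Require Import all_classical topology.

Set Implicit Arguments.
Unset Strict Implicit.
Unset Printing Implicit Defensive.

Import GRing.Theory.

Local Open Scope classical_set_scope.
Local Open Scope ring_scope.

(** * Groups acting on finite sets through elements of p-power order *)

(** An element of prime order other than [p] in [Q] would fix every point, so by Cauchy [Q] is a
    [p]-group, and its number of fixed points is congruent to [#|T|] modulo [p]. The exponent [n]
    may depend on the point. *)
Lemma dvdn_card_no_fixpoint (p : nat) (T : finType) (Q : {group {perm T}}) :
  prime p ->
  (forall s x, s \in Q -> exists n, (s ^+ (p ^ n)%N)%g x = x) ->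
  (forall x, exists2 s, s \in Q & s x != x) -> (p %| #|T|)%N.
Proof.
move=> p_pr ordQ nofixQ.
have fixX (s : {perm T}) x n : s x = x -> (s ^+ n)%g x = x.
  by move=> sx; elim: n => [|n IHn]; rewrite ?expg0 ?perm1 // expgS permM sx.
have pQ : (p.-group Q)%g.
  apply/pgroupP => q q_pr /(Cauchy q_pr) [s sQ os]; apply: contraT => neq_qp.
  have s_id x : s x = x.
    have [n sx] := ordQ s x sQ.
    (* The order [q] of [s] is prime to [p ^ n], so [s] is a power of [s ^+ (p ^ n)], which fixes
       [x]. *)
    have := fixX _ x (expg_invn <[s]>%g (p ^ n)) sx.
    rewrite expgK ?cycle_id // coprimeXr //.
    by rewrite [#|_|]os prime_coprime // dvdn_prime2.
  have s1 : s = 1%g by apply/permP => x; rewrite perm1.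
  by rewrite -os s1 order1 in q_pr.
have := @pgroup_fix_mod _ _ _ (perm_action T) _ Q (finset.setTfor T) pQ.
have -> : 'Fix_(finset.setTfor T | perm_action T)(Q)%g = finset.set0.
  rewrite finset.setTI; apply/finset.setP => x; rewrite finset.in_set0.
  apply/negP => /afixP fx.
  by have [s sQ /eqP[]] := nofixQ x; exact: fx.
rewrite finset.cardsT finset.cards0 mod0n => /(_ _)/eqP; apply.
by apply/actsP => s _ x; rewrite !finset.inE.
Qed.

Section FiniteStableSubset.
Variables (gT : groupType) (U : choiceType) (a : gT -> U -> U).
Hypotheses (a1 : forall x, a 1%g x = x)
  (aM : forall g h x, a (g * h)%g x = a g (a h x)).
Variables (L : set gT) (E : {fset U}).
Hypotheses (subL : group_closed [in L])
  (LE : forall g x, L g -> x \in E -> a g x \in E).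

Lemma perm_of_action :
  exists sigma : gT -> {perm E},
    forall g x, L g -> val (sigma g x) = a g (val x).
Proof.
have : forall g, exists s : {perm E}, forall x, L g -> val (s x) = a g (val x).
  (* For [g] outside [L], which need not preserve [E], the identity serves as default value. *)
  move=> g; have [Lg|nLg] := pselect (L g); last by exists 1%g.
  pose f (x : E) : E := FSetSub (LE Lg (valP x)).
  have inj_f : injective f.
    move=> x y /(congr1 val)/(congr1 (a g^-1%g)) /=.
    by rewrite -!aM mulVg !a1 => /val_inj.
  by exists (perm inj_f) => x _; rewrite permE.
by move=> /choice[sigma sigmaP]; exists sigma => g x; apply: sigmaP.
Qed.

(** The group [L] may be infinite, but its image among the permutations of [E] is a finite group, to
    which the preceding count applies. *)
Lemma dvdn_card_stable_fset (p : nat) : prime p ->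
  (forall g x, L g -> x \in E -> exists n, a (g ^+ (p ^ n))%g x = x) ->
  (forall x, x \in E -> exists2 g, L g & a g x <> x) -> (p %| #|` E|)%N.
Proof.
move=> p_pr ordL nofix; have [sigma sigmaE] := perm_of_action.
have L1 : L 1%g by case: subL => /set_mem.
have LM g h : L g -> L h -> L (g * h)%g.
  by move=> /mem_set Lg /mem_set Lh; apply/set_mem/(group_closedM subL).
have sigmaX g n x : L g -> val ((sigma g ^+ n)%g x) = a (g ^+ n)%g (val x).
  move=> Lg; elim: n => [|n IHn]; first by rewrite !expg0 perm1 a1.
  by rewrite expgSr permM sigmaE // IHn -aM -expgS.
pose Q := finset.finset (fun s : {perm E} => `[<exists2 g, L g & s = sigma g>]).
have Q_group : group_set Q.
  apply/group_setP; split=> [|s t].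
    rewrite finset.inE; apply/asboolP; exists 1%g => //.
    by apply/permP => x; apply: val_inj; rewrite sigmaE // a1 perm1.
  rewrite !finset.inE => /asboolP[g Lg ->] /asboolP[h Lh ->].
  (* The factors are reversed: permutations compose from left to right, whereas [a] is a left
     action. *)
  apply/asboolP; exists (h * g)%g; first exact: LM.
  apply/permP => x; apply: val_inj; rewrite permM !sigmaE // ?aM //.
  exact: LM.
rewrite cardfE; apply: (@dvdn_card_no_fixpoint p _ (Group Q_group)) => //.
  move=> s x; rewrite finset.inE => /asboolP[g Lg ->].
  have [n gx] := ordL g (val x) Lg (valP x); exists n.
  by apply: val_inj; rewrite sigmaX.
move=> x; have [g Lg gx] := nofix (val x) (valP x); exists (sigma g).
  by rewrite finset.inE; apply/asboolP; exists g.
by apply/eqP => /(congr1 val); rewrite sigmaE.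
Qed.

End FiniteStableSubset.

(** * Open subgroups of pro-p groups *)

Section Subgroups.
Local Open Scope group_scope.
Variable G : topologicalGroupType.
Implicit Types (A H K M N : set G) (g h k : G).

Lemma subgroup1 H : is_subgroup H -> H 1.
Proof. by case=> /set_mem. Qed.

Lemma subgroupM H g h : is_subgroup H -> H g -> H h -> H (g * h).
Proof.
by move=> sH /mem_set Hg /mem_set Hh; apply/set_mem/(group_closedM sH).
Qed.

Lemma subgroupV H g : is_subgroup H -> H g -> H g^-1.
Proof. by move=> sH /mem_set Hg; apply/set_mem/(group_closedV sH). Qed.

Lemma is_subgroupP H : H 1 -> (forall g h, H g -> H h -> H (g * h^-1)) ->
  is_subgroup H.
Proof.
move=> H1 HB; split=> [|g h /set_mem Hg /set_mem Hh]; apply/mem_set => //.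
exact: HB.
Qed.

Lemma subgroupI H K : is_subgroup H -> is_subgroup K -> is_subgroup (H `&` K).
Proof.
move=> sH sK; apply: is_subgroupP => [|g h [Hg Kg] [Hh Kh]].
  by split; apply: subgroup1.
by split; apply: subgroupM => //; apply: subgroupV.
Qed.

Lemma mul_set1P g A x : mul_set [set g] A x <-> A (g^-1 * x).
Proof.
split=> [[_ -> [y Ay <-]]|Ax]; first by rewrite mulKg.
by exists g => //; exists (g^-1 * x); rewrite ?mulVKg.
Qed.

Lemma mul_set11 A : mul_set [set 1] A = A.
Proof. by apply/seteqP; split=> x; rewrite mul_set1P invg1 mul1g. Qed.

Lemma mul_set1M g h A :
  mul_set [set g * h] A = mul_set [set g] (mul_set [set h] A).
Proof.
by apply/seteqP; split=> x; rewrite !mul_set1P invMg mulgA.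
Qed.

Lemma mul_set1_refl g M : is_subgroup M -> mul_set [set g] M g.
Proof. by move=> sM; apply/mul_set1P; rewrite mulVg; apply: subgroup1. Qed.

Lemma eq_mul_set1 g h M : is_subgroup M ->
  mul_set [set g] M h -> mul_set [set h] M = mul_set [set g] M.
Proof.
move=> sM /mul_set1P Mgh; apply/seteqP; split=> x; rewrite !mul_set1P => Mx.
  have -> : g^-1 * x = (g^-1 * h) * (h^-1 * x) by rewrite -mulgA mulVKg.
  exact: subgroupM.
have -> : h^-1 * x = (g^-1 * h)^-1 * (g^-1 * x).
  by rewrite invMg invgK -mulgA mulVKg.
by apply: subgroupM => //; apply: subgroupV.
Qed.

Lemma continuous_mul (T : topologicalType) (a b : T -> G) :
  continuous a -> continuous b -> continuous (fun x => a x * b x).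
Proof.
move=> ca cb x.
apply: (@continuous_comp _ _ _ (fun y => (a y, b y)) (fun z => z.1 * z.2)).
  by apply: cvg_pair; [exact: ca | exact: cb].
exact: mulg_continuous.
Qed.

Lemma continuous_mul2 g h : continuous (fun x : G => g * x * h).
Proof.
apply: continuous_mul; last exact: cst_continuous.
by apply: continuous_mul => [|x]; [exact: cst_continuous | exact: cvg_id].
Qed.

Lemma open_mul2 g h A : open A -> open [set x | A (g * x * h)].
Proof. by move=> oA; apply: open_comp => // x _; apply: continuous_mul2. Qed.

Lemma open_subgroup H : is_subgroup H -> nbhs 1 H -> open H.
Proof.
move=> sH nH; rewrite openE => g Hg; rewrite /interior.
have : nbhs g [set x | H (g^-1 * x * 1)].
  by move: (@continuous_mul2 g^-1 1 g H); rewrite mulVg mulg1; apply.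
apply: filterS => x /=; rewrite mulg1 => Hx.
by rewrite -(mulVKg g x); apply: subgroupM.
Qed.


Lemma open_nbhs1 H : is_subgroup H -> open H -> nbhs 1 H.
Proof.
by move=> sH oH; apply: open_nbhs_nbhs; split=> //; apply: subgroup1.
Qed.

Section ProPSubgroup.
Variables (p : nat) (K : set G).
Hypotheses (p_pr : prime p) (oK : open K) (ppK : pro_p p K).

Let sK : is_subgroup K. Proof. by case: ppK => -[]. Qed.
Let cK : compact K. Proof. by case: ppK => -[]. Qed.

(** The intersection of [K] with all [K]-conjugates of [S] is open by compactness: conjugation is
    continuous at each [(k, 1)], and the resulting neighbourhoods of [1] can be chosen uniformly in
    [k]. *)
Lemma open_normal_core S : is_subgroup S -> open S ->
  exists2 N, is_normal_subgroup N K /\ open N & N `<=` S.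
Proof.
move=> sS oS; pose N := [set n | K n /\ forall k, K k -> S (n ^ k)].
have sN : is_subgroup N.
  apply: is_subgroupP.
    by split=> [|k _]; rewrite ?conj1g; apply: subgroup1.
  move=> g h [Kg Sg] [Kh Sh]; split=> [|k Kk].
    by apply: subgroupM => //; apply: subgroupV.
  rewrite conjMg conjVg; apply: subgroupM => //; first exact: Sg.
  by apply: subgroupV => //; exact: Sh.
exists N; last by move=> n [_ /(_ 1 (subgroup1 sK))]; rewrite conjg1.
split; first split=> // [n []|n k [Kn Sn] Kk] //.
  split=> [|l Kl]; last by rewrite -conjgM; apply: Sn; apply: subgroupM.
  by rewrite conjgE; apply: subgroupM; [|apply: subgroupV|apply: subgroupM].
apply: open_subgroup => //.
have : \forall n \near nbhs 1, K `<=` fun k => S (n ^ k).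
  apply: (proj1 (compact_near_coveringP _) cK G (nbhs 1)) => k Kk.
  have cc : continuous (fun z : G * G => z.1^-1 * (z.2 * z.1)).
    apply: continuous_mul => [z|].
      apply: (@continuous_comp _ _ _ fst (fun x : G => x^-1)).
        exact: cvg_fst.
      exact: invg_continuous.
    by apply: continuous_mul => z; [exact: cvg_snd | exact: cvg_fst].
  apply: (cc (k, 1)); rewrite /= mul1g mulVg; exact: open_nbhs1.
by apply: filterS2 (open_nbhs1 sK oK) => n Kn Sn; split.
Qed.

(** For a normal core [N] of [S], the class of [k] in the finite [p]-group [K / N] has [p]-power
    order. Instead of the quotient group, the permutation [s] of the set of cosets induced by [k] is
    used: a power of [s] fixes a coset exactly when the same power of [k] lies in [N]. *)
Lemma pro_p_expg S k : is_subgroup S -> open S -> K k ->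
  exists n, S (k ^+ (p ^ n)%N).
Proof.
move=> sS oS Kk; have [N [nN oN] NS] := open_normal_core sS oS.
suff [n Nk] : exists n, N (k ^+ (p ^ n)%N) by exists n; apply: NS.
have [sN NK NJ] := nN.
have oKN : open_in K N by apply: open_subspaceW.
have [_ /(_ N nN oKN)[n cardKN]] := ppK.
have fKN : finite_set (cosets K N) by exists (p ^ n)%N.
pose E := fset_set (cosets K N).
have EP A : (A \in E) = `[<cosets K N A>] by rewrite in_fset_set.
have cE : #|{: E}| = (p ^ n)%N by rewrite -cardfE; apply: card_fset_set.
pose a g A := mul_set [set g] A.
have LE g A : K g -> A \in E -> a g A \in E.
  rewrite !EP => Kg /asboolP[h Kh <-]; apply/asboolP.
  by exists (g * h); [exact: subgroupM | rewrite mul_set1M].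
have [sigma sigmaE] := perm_of_action mul_set11 mul_set1M LE.
set s := sigma k.
have sX i (A : E) : val ((s ^+ i)%g A) = a (k ^+ i) (val A).
  elim: i => [|i IHi]; first by rewrite !expg0 perm1 /a mul_set11.
  by rewrite expgSr permM sigmaE // IHi /a -mul_set1M -expgS.
have sX_fix i (A : E) : (s ^+ i)%g A = A -> N (k ^+ i).
  have := valP A; rewrite EP => /asboolP[h Kh hA].
  move=> /(congr1 val); rewrite sX -hA /a -mul_set1M => eqA.
  have := mul_set1_refl (k ^+ i * h) sN; rewrite eqA => /mul_set1P Nh.
  have := NJ _ _ Nh (subgroupV sK Kh).
  by rewrite conjgE invgK !mulgA mulgV mul1g -mulgA mulgV mulg1.
have sX1 i : N (k ^+ i) -> (s ^+ i)%g = 1%g.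
  move=> Nk; apply/permP => A; apply: val_inj; rewrite sX perm1.
  have := valP A; rewrite EP => /asboolP[h Kh <-]; rewrite /a -mul_set1M.
  apply: eq_mul_set1 => //; apply/mul_set1P.
  by have := NJ _ _ Nk Kh; rewrite conjgE.
(* A power of [s] of prime order [q] acts freely on [K / N], whose cardinality
   is a power of [p]. *)
have p_s : (p.-nat #[s])%g.
  apply/pnatP => // q q_pr q_s.
  set r := (s ^+ (#[s] %/ q))%g.
  have or : #[r]%g = q.
    by rewrite orderXdiv ?divn_dvd ?dvdn_div // divnA // mulKn.
  have : (q %| #|{: E}|)%N.
    apply: (@dvdn_card_no_fixpoint q _ <[r]>%G) => //.
      move=> _ x /cycleP[i ->]; exists 1%N.
      by rewrite expn1 expgnAC -or expg_order expg1n perm1.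
    move=> x; exists r; first exact: cycle_id.
    apply/eqP => /sX_fix/sX1; rewrite -/r => r1.
    by rewrite r1 order1 in or; rewrite -or in q_pr.
  by rewrite cE Euclid_dvdX // => /andP[+ _]; rewrite dvdn_prime2.
have /p_natP[m om] := p_s; exists m.
have E0 : mul_set [set 1] N \in E.
  by rewrite EP; apply/asboolP; exists 1; first exact: subgroup1.
by apply: (sX_fix _ (FSetSub E0)); rewrite -om expg_order perm1.
Qed.

End ProPSubgroup.

End Subgroups.

(** * Vectors fixed by pro-p groups *)

(** Since [x ^+ p - 1 = (x - 1) ^+ p], the only [p]-th root of [1] is [1]. *)
Lemma pchar_expn_eq1 (F : fieldType) (p n : nat) (x : F) :
  p \in [pchar F] -> x ^+ (p ^ n) = 1 -> x = 1.
Proof.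
move=> charF; elim: n x => [|n IHn] x; first by rewrite expn0 expr1.
rewrite expnS exprM => /IHn xp1; apply/eqP; rewrite -subr_eq0.
have : (x - 1) ^+ p == 0.
  rewrite -(pFrobenius_autE charF) pFrobenius_autB_comm; last exact: commr1.
  by rewrite pFrobenius_aut1 pFrobenius_autE xp1 subrr.
by rewrite expf_eq0 => /andP[].
Qed.

Lemma mulrn_pchar_lmod (F : fieldType) (p : nat) (V : lmodType F) (v : V) n :
  p \in [pchar F] -> (p %| n)%N -> v *+ n = 0.
Proof.
move=> charF; rewrite (dvdn_pcharf charF) -scaler_nat => /eqP->.
exact: scale0r.
Qed.

(** Entries of [l] may be repeated without bound, yet the sums only fill the finite span of [l] over
    the prime field. A list containing [0] and stable under adding entries of [l] contains them
    all. *)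
Lemma finite_sums (F : fieldType) (p : nat) (V : lmodType F) (l : seq V) :
  p \in [pchar F] ->
  finite_set [set \sum_(t <- s) t | s in [set s | {subset s <= l}]].
Proof.
move=> charF; suff [Y Y0 Yl] : exists2 Y : seq V, 0 \in Y &
    forall t y, t \in l -> y \in Y -> t + y \in Y.
  apply: (sub_finite_set _ (finite_seq Y)) => _ [s + <-].
  elim: s => [|t s IHs] sl; first by rewrite big_nil.
  rewrite big_cons; apply: Yl; first by apply: sl; rewrite mem_head.
  by apply: IHs => u us; apply: sl; rewrite inE us orbT.
have p_gt0 : (0 < p)%N by apply: prime_gt0; case/andP: charF.
elim: l => [|t l [Y Y0 Yl]]; first by exists [:: 0]; rewrite ?mem_head.
(* Multiplicities of [t] matter only modulo [p]. *)
exists [seq t *+ i + y | i <- iota 0 p, y <- Y].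
  apply/allpairsP; exists (0%N, 0); split=> //=; last by rewrite mulr0n addr0.
  by rewrite mem_iota.
move=> u _ + /allpairsP[[i y] /= [ip Yy ->]]; rewrite inE => /predU1P[->|lu].
  apply/allpairsP; exists (i.+1 %% p, y)%N; split=> //=.
    by rewrite mem_iota add0n ltn_mod.
  rewrite addrA -mulrS {1}(divn_eq i.+1 p) mulrnDr.
  have -> : t *+ (i.+1 %/ p * p) = 0.
    by apply: (mulrn_pchar_lmod _ charF); apply: dvdn_mull.
  by rewrite add0r.
apply/allpairsP; exists (i, u + y); split=> //=; first exact: Yl.
by rewrite addrCA.
Qed.

Section SmoothReps.
Variables (p : nat) (F : fieldType) (G : topologicalGroupType).
Variables (C : set G) (chi : G -> F).
Implicit Types (P X Y : smooth_rep C chi).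

Definition rep_stab P (v : P) : set G := [set g | rep_act P g v = v].

Lemma rep_actV P g (v w : P) : rep_act P g v = w -> rep_act P g^-1%g w = v.
Proof. by move=> <-; rewrite -rep_actM mulVg rep_act1. Qed.

Lemma rep_stab_subgroup P (v : P) : is_subgroup (rep_stab v).
Proof.
apply: is_subgroupP => [|g h gv hv]; first exact: rep_act1.
by rewrite /rep_stab /= rep_actM (rep_actV hv).
Qed.

Section FixedVector.
Hypothesis charF : p \in [pchar F].
Variable K : set G.
Hypotheses (oK : open K) (ppK : pro_p p K).

Let p_pr : prime p. Proof. by case/andP: charF. Qed.
Let sK : is_subgroup K. Proof. by case: ppK => -[]. Qed.

(** By smoothness some power of [k] with exponent [p ^ n] fixes [v], so [x ^+ (p ^ n) = 1]. This is
    how the scalars of the central character are seen to be trivial where they come from [K]. *)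
Lemma rep_eigenvalue1 P (v : P) (k : G) (x : F) :
  v != 0 -> K k -> rep_act P k v = x *: v -> x = 1.
Proof.
move=> v0 Kk kv.
have [n] := pro_p_expg p_pr oK ppK (rep_stab_subgroup v) (rep_smooth v) Kk.
have kX m : rep_act P (k ^+ m)%g v = x ^+ m *: v.
  elim: m => [|m IHm]; first by rewrite expg0 rep_act1 expr0 scale1r.
  by rewrite expgS rep_actM IHm linearZ /= kv scalerA exprSr.
rewrite /rep_stab /= kX => /eqP; rewrite -subr_eq0 -{2}(scale1r v) -scalerBl.
rewrite scaler_eq0 (negPf v0) orbF subr_eq0 => /eqP.
exact: pchar_expn_eq1.
Qed.

Lemma finite_orbit P (v : P) : finite_set [set rep_act P k v | k in K].
Proof.
have [N [nN oN] NS] :=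
  open_normal_core oK ppK (rep_stab_subgroup v) (rep_smooth v).
have oKN : open_in K N by apply: open_subspaceW.
have [_ /(_ N nN oKN)[n cardKN]] := ppK.
have fKN : finite_set (cosets K N) by exists (p ^ n)%N.
(* As [N] fixes [v], the vector [rep_act P k v] depends only on the coset of [k]; [xget] picks a
   representative of it. *)
apply: sub_finite_set (finite_image (fun A => rep_act P (xget 1%g A) v) fKN).
move=> _ [k Kk <-]; exists (mul_set [set k] N); first by exists k.
have sN : is_subgroup N by case: nN.
have : mul_set [set k] N (xget 1%g (mul_set [set k] N)).
  exact: xgetI (mul_set1_refl k sN).
move=> /mul_set1P/NS; rewrite /rep_stab /= rep_actM => /rep_actV.
by rewrite invgK.
Qed.

Lemma exists_fixed_vector P : (exists v : P, v <> 0) ->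
  exists2 w : P, w != 0 & forall k, K k -> rep_act P k w = w.
Proof.
move=> [v /eqP v0]; apply: contrapT => nofix.
(* [Z] is a finite additive group on which [K] acts.  Its translation by [v]
   has order [p] and no fixed point, so [p] divides [#|Z|]; if [0] were the only
   point fixed by [K], then [p] would also divide [#|Z| - 1]. *)
pose l : seq P := fset_set [set rep_act P k v | k in K].
have lP t : t \in l = `[<exists2 k, K k & rep_act P k v = t>].
  by rewrite in_fset_set //; apply: finite_orbit.
pose Z := [set \sum_(t <- s) t | s in [set s | {subset s <= l}]].
pose E := fset_set Z.
have EP x : x \in E = `[<Z x>].
  by rewrite in_fset_set; last exact: (finite_sums _ charF).
have E0 : 0 \in E.
  by rewrite EP; apply/asboolP; exists [::] => [t|]; rewrite ?big_nil ?in_nil.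
have EK k x : K k -> x \in E -> rep_act P k x \in E.
  rewrite !EP => Kk /asboolP[s sl <-]; apply/asboolP.
  exists [seq rep_act P k t | t <- s]; last by rewrite big_map linear_sum.
  move=> _ /mapP[t /sl + ->]; rewrite !lP => /asboolP[h Kh <-].
  by apply/asboolP; exists (k * h)%g; rewrite ?rep_actM //; apply: subgroupM.
have Ev x : x \in E -> v + x \in E.
  rewrite !EP => /asboolP[s sl <-]; apply/asboolP.
  exists (v :: s); last by rewrite big_cons.
  move=> t; rewrite inE => /predU1P[->|/sl//]; rewrite lP; apply/asboolP.
  by exists 1%g; [exact: subgroup1 | rewrite rep_act1].
have pE : (p %| #|` E|)%N.
  pose tr (x : E) : E := FSetSub (Ev _ (valP x)).
  have tr_inj : injective tr by move=> x y /(congr1 val)/addrI/val_inj.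
  pose s := perm tr_inj.
  have sX i (x : E) : val ((s ^+ i)%g x) = v *+ i + val x.
    elim: i => [|i IHi]; first by rewrite expg0 perm1 add0r.
    by rewrite expgSr permM permE /= IHi addrA mulrS.
  rewrite cardfE; apply: (@dvdn_card_no_fixpoint p _ <[s]>%G) => //.
    move=> _ x /cycleP[i ->]; exists 1%N; apply: val_inj.
    rewrite expn1 -expgnA sX.
    by rewrite (mulrn_pchar_lmod _ charF) ?add0r // dvdn_mull.
  move=> x; exists s; first exact: cycle_id.
  apply/eqP => /(congr1 val); rewrite -(expg1 s) sX mulr1n => /eqP.
  by rewrite -subr_eq0 addrK (negPf v0).
have : (p %| #|` (E `\ (0 : P)%R)%fset|)%N.
  apply: (@dvdn_card_stable_fset _ _ (fun g => rep_act P g) _ _ K) => //.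
  - by move=> x; apply: rep_act1.
  - by move=> g h x; apply: rep_actM.
  - move=> k x Kk; rewrite !inE => /andP[x0 Ex]; rewrite EK // andbT.
    apply: contraNneq x0 => /rep_actV; rewrite linear0 => <- //.
  - move=> k x Kk _.
    have stab_x := rep_stab_subgroup x.
    by have [n] := pro_p_expg p_pr oK ppK stab_x (rep_smooth x) Kk; exists n.
  - move=> x; rewrite !inE => /andP[x0 Ex]; apply: contrapT => fx.
    apply: nofix; exists x => // k Kk; apply: contrapT => kx.
    by apply: fx; exists k.
move: pE; rewrite (cardfsD1 (0 : P)) E0 => /[swap] pE'; rewrite dvdn_addl //.
by rewrite dvdn1 => /eqP p1; move: p_pr; rewrite p1.
Qed.

End FixedVector.
End SmoothReps.

(** * Finitely supported equivariant families *)

Section EquivariantFamily.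
Variables (F : fieldType) (G : topologicalGroupType).
Variables (C : set G) (chi : G -> F) (P : smooth_rep C chi) (I : choiceType).

(** A [G]-set [I] with subspaces of [P] that [G] permutes compatibly. The last two fields make
    finitely supported families smooth with central character [chi]; they are asked only at indices
    carrying a nonzero vector, because the index set used below contains arbitrary pairs of
    subsets. *)
Record equivariant_family := EquivariantFamily {
  fam_act : G -> I -> I;
  fam_act1 : forall i, fam_act 1%g i = i;
  fam_actM : forall g h i, fam_act (g * h)%g i = fam_act g (fam_act h i);
  fam :> I -> set P;
  fam0 : forall i, fam i 0;
  fam_linear : forall i a u v, fam i u -> fam i v -> fam i (a *: u + v);
  fam_equivariant : forall g i u, fam i u -> fam (fam_act g i) (rep_act P g u);
  fam_stab : forall i u, fam i u -> u != 0 ->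
    nbhs 1%g [set g | fam_act g i = i];
  fam_central : forall i u c, fam i u -> u != 0 -> C c -> fam_act c i = i
}.

Variable W : equivariant_family.
Local Notation "g \act i" := (fam_act W g i) (at level 40, left associativity).

Definition finsec_pred : {pred I -> P} :=
  fun f => `[<finite_set [set i | f i != 0] /\ forall i, W i (f i)>].

Lemma finsec_submod : submod_closed finsec_pred.
Proof.
split=> [|a f g /asboolP[ff Wf] /asboolP[fg Wg]]; apply/asboolP.
  split=> [|i]; last exact: fam0.
  rewrite (_ : [set _ | _] = set0) //.
  by apply/seteqP; split=> i //=; rewrite eqxx.
split=> [|i]; last exact: fam_linear.
have fU : finite_set ([set i | f i != 0] `|` [set i | g i != 0]).
  by rewrite finite_setU.
apply: sub_finite_set fU => i /=.
apply: contraPP => /not_orP[/negP/negPn/eqP fi /negP/negPn/eqP gi].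
by rewrite fctE /= fctE /= fi gi scaler0 addr0 eqxx.
Qed.

HB.instance Definition _ :=
  GRing.isSubmodClosed.Build F (I -> P) finsec_pred finsec_submod.

Record finsec :=
  FinSec { finsec_val :> I -> P; _ : finsec_val \in finsec_pred }.

HB.instance Definition _ := [isSub for finsec_val].
HB.instance Definition _ := [Choice of finsec by <:].
HB.instance Definition _ := [SubChoice_isSubLmodule of finsec by <:].

Implicit Types f : finsec.

Definition finsec_supp f : {fset I} := fset_set [set i | f i != 0].

Lemma finsec_finite f : finite_set [set i | f i != 0].
Proof. by case: f => f /= /asboolP[]. Qed.

Lemma finsec_fam f i : W i (f i).
Proof. by case: f => f /= /asboolP[]. Qed.

Lemma in_finsec_supp f i : (i \in finsec_supp f) = (f i != 0).
Proof.
rewrite in_fset_set; last exact: finsec_finite.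
by apply/idP/idP => [/set_mem|fi] //; apply/mem_set.
Qed.

Lemma fam_actK g : cancel (fam_act W g) (fam_act W g^-1%g).
Proof. by move=> i; rewrite -fam_actM mulVg fam_act1. Qed.

Lemma fam_actKV g : cancel (fam_act W g^-1%g) (fam_act W g).
Proof. by move=> i; rewrite -fam_actM mulgV fam_act1. Qed.

Lemma fam_stab_subgroup i : is_subgroup [set g | g \act i = i].
Proof.
apply: is_subgroupP => [|g h gi hi]; first exact: fam_act1.
by rewrite /= fam_actM -{1}hi fam_actK.
Qed.

Lemma finsec_act_subproof g f :
  (fun i => rep_act P g (f (g^-1%g \act i))) \in finsec_pred.
Proof.
apply/asboolP; split=> [|i]; last first.
  by rewrite -{1}(fam_actKV g i); apply: fam_equivariant; apply: finsec_fam.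
apply: sub_finite_set (finite_image (fam_act W g) (finsec_finite f)) => i /= fi.
exists (g^-1%g \act i) => /=; last by rewrite fam_actKV.
by apply: contra_neq fi => ->; rewrite linear0.
Qed.

Definition finsec_act g f : finsec := FinSec (finsec_act_subproof g f).

Lemma finsec_act_linear g : linear (finsec_act g).
Proof.
move=> a f1 f2; apply: val_inj; apply/funext => i /=.
exact: linearP.
Qed.

HB.instance Definition _ g :=
  GRing.isLinear.Build F finsec finsec *:%R
    (finsec_act g) (finsec_act_linear g).

Lemma finsec_actE g f i : finsec_act g f i = rep_act P g (f (g^-1%g \act i)).
Proof. by []. Qed.

(** If one of the two indices lies in the support, [g] fixes it and they coincide; otherwise both
    values are zero. Hence such a [g] acts on the values alone. *)
Lemma finsec_fixes g f : (forall i, f i != 0 -> g \act i = i) ->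
  forall i, f (g^-1%g \act i) = f i.
Proof.
move=> gf i; have [fi|/gf gi] := eqVneq (f i) 0; last first.
  by rewrite -{1}gi fam_actK.
have [-> //|/gf] := eqVneq (f (g^-1%g \act i)) 0.
by rewrite fam_actKV => <-.
Qed.

Lemma finsec_act1 f : finsec_act 1%g f = f.
Proof.
by apply: val_inj; apply/funext => i /=; rewrite invg1 fam_act1 rep_act1.
Qed.

Lemma finsec_actM g h f :
  finsec_act (g * h)%g f = finsec_act g (finsec_act h f).
Proof.
by apply: val_inj; apply/funext => i /=; rewrite invMg fam_actM rep_actM.
Qed.

(** The support is finite, so the stabilizers of its indices and of the values there intersect in a
    neighbourhood of [1], which fixes [f]. *)
Lemma finsec_smooth f : open [set g | finsec_act g f = f].
Proof.
apply: open_subgroup.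
  apply: is_subgroupP => [|g h gf hf]; first exact: finsec_act1.
  by rewrite /= -{1}hf -finsec_actM mulgVK.
have : nbhs 1%g (\bigcap_(i in [set` finsec_supp f])
    ([set g | g \act i = i] `&` rep_stab (f i))).
  apply: filter_bigI => i; rewrite in_finsec_supp => fi; apply: filterI.
    exact: fam_stab (finsec_fam f i) fi.
  exact: open_nbhs1 (rep_stab_subgroup (f i)) (rep_smooth (f i)).
apply: filterS => g gf; apply: val_inj; apply/funext => i /=.
rewrite finsec_fixes => [|j fj]; last first.
  by have [] := gf j; rewrite /= ?in_finsec_supp.
have [->|fi] := eqVneq (f i) 0; first exact: linear0.
by have [] := gf i; rewrite /= ?in_finsec_supp.
Qed.

Lemma finsec_central c f : C c -> finsec_act c f = chi c *: f.
Proof.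
move=> Cc; apply: val_inj; apply/funext => i /=.
rewrite finsec_fixes => [|j fj]; first exact: rep_central.
exact: fam_central (finsec_fam f j) fj Cc.
Qed.

Definition finsec_rep : smooth_rep C chi :=
  @SmoothRep F G C chi finsec (fun g => finsec_act g)
    finsec_act1 finsec_actM finsec_smooth finsec_central.

Definition finsec_sum f : P := \sum_(i \in [set: I]) f i.

(** Any finite [A] above the support is allowed, so that two families can be summed over a common
    index set. *)
Lemma finsec_sumE f (A : {fset I}) : (finsec_supp f `<=` A)%fset ->
  finsec_sum f = \sum_(i <- A) f i.
Proof.
move=> /fsubsetP fA; apply: fsbigTE => i; apply: contraNeq => fi.
by apply: fA; rewrite in_finsec_supp.
Qed.

Lemma finsec_sum_linear : linear finsec_sum.
Proof.
move=> a f g; pose A := (finsec_supp f `|` finsec_supp g)%fset.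
rewrite (@finsec_sumE f A) ?fsubsetUl // (@finsec_sumE g A) ?fsubsetUr //.
rewrite (@finsec_sumE _ A).
  by rewrite scaler_sumr -big_split.
apply/fsubsetP => i; rewrite !inE !in_finsec_supp; apply: contraNT.
rewrite negb_or !negbK => /andP[/eqP fi /eqP gi].
by rewrite [X in X == _](_ : _ = a *: f i + g i) // fi gi scaler0 addr0.
Qed.

HB.instance Definition _ :=
  GRing.isLinear.Build F finsec P *:%R finsec_sum finsec_sum_linear.

Lemma finsec_sum_equivariant g f :
  finsec_sum (finsec_act g f) = rep_act P g (finsec_sum f).
Proof.
rewrite [in RHS](@finsec_sumE f (finsec_supp f)) // linear_sum.
rewrite /finsec_sum (@reindex_fsbigT _ _ _ _ _ (fam_act W g)); last first.
  by exists (fam_act W g^-1%g); [exact: fam_actK | exact: fam_actKV].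
under eq_fsbigr do rewrite finsec_actE fam_actK.
apply: fsbigTE => i; rewrite in_finsec_supp negbK => /eqP ->; exact: linear0.
Qed.

Definition finsec_sum_hom : rep_hom finsec_rep P :=
  @RepHom F G C chi finsec_rep P finsec_sum finsec_sum_equivariant.

Lemma finsec_dirac i u : W i u -> exists f, finsec_sum f = u.
Proof.
move=> Wu; pose f j := if j == i then u else 0.
have f_fam : f \in finsec_pred.
  apply/asboolP; split=> [|j]; last first.
    by rewrite /f; case: eqP => [->|_] //; apply: fam0.
  apply: sub_finite_set (finite_set1 i) => j; rewrite /f /=.
by have [->|_] := eqVneq j i; rewrite ?eqxx.
exists (FinSec f_fam); rewrite (@finsec_sumE _ [fset i]%fset).
  by rewrite big_seq_fset1 /= /f eqxx.
apply/fsubsetP => j; rewrite in_finsec_supp inE /= /f.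
by case: ifP => // _; rewrite eqxx.
Qed.

(** * Vanishing of the sum of a [K]-invariant family *)

Section InvariantSections.
Variables (p : nat) (K : set G) (pi : I -> I).
Hypotheses (charF : p \in [pchar F]) (oK : open K) (ppK : pro_p p K).
Hypothesis (pi_equivariant : forall g i, pi (g \act i) = g \act pi i).
Hypothesis fiber_trivial : forall i u k,
  W i u -> u != 0 -> K k -> k \act pi i = pi i -> rep_act P k u = u.
Hypothesis fiber_moves : forall i u, W i u -> u != 0 ->
  exists k, [/\ K k, k \act pi i = pi i & k \act i <> i].

Let p_pr : prime p. Proof. by case/andP: charF. Qed.
Let sK : is_subgroup K. Proof. by case: ppK => -[]. Qed.

(* The sum is grouped by the fibres of [pi] and the values of [f]: the
   stabilizer in [K] of a point of the image of [pi] acts without fixed points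
   on each such group of indices, whose size is therefore divisible by [p]. *)
Lemma finsec_sum_invariant f : (forall k, K k -> finsec_act k f = f) ->
  finsec_sum f = 0.
Proof.
move=> fK; rewrite (@finsec_sumE f (finsec_supp f)) //.
rewrite (partition_big_imfset _ (fun i => (pi i, f i))) /=.
apply: big1 => -[j u] _; rewrite big_fset_condE.
set E := [fset _ | _ in _ & _]%fset.
have EP i : (i \in E) = (f i != 0) && ((pi i, f i) == (j, u)).
  by rewrite !inE in_finsec_supp.
rewrite big_seq (eq_bigr (fun _ => u)); last first.
  by move=> i; rewrite EP => /andP[_ /eqP[]].
rewrite -big_seq big_const_seq count_predT iter_addr_0.
apply: (mulrn_pchar_lmod _ charF).
pose L := K `&` [set k | k \act j = j].
apply: (dvdn_card_stable_fset (@fam_act1 W) (@fam_actM W) (L := L)) => //.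
- exact: subgroupI sK (fam_stab_subgroup j).
- move=> k i [Kk kj]; rewrite !EP => /andP[fi /eqP[pij fu]].
  have ki : k \act pi i = pi i by rewrite pij.
  (* Invariance of [f] makes its value at the translated index equal to [rep_act P k (f i)], and [k]
     fixes [f i] because it fixes [pi i]. *)
  have fki : f (k \act i) = f i.
    rewrite -{1}(fK k Kk) finsec_actE fam_actK.
    exact: fiber_trivial (finsec_fam f i) fi Kk ki.
  by rewrite fki fi pi_equivariant pij kj fu eqxx.
- move=> k i [Kk _]; rewrite EP => /andP[fi _].
  apply: (pro_p_expg p_pr oK ppK (fam_stab_subgroup i) _ Kk).
  exact: open_subgroup (fam_stab_subgroup i) (fam_stab (finsec_fam f i) fi).
- move=> i; rewrite EP => /andP[fi /eqP[pij _]].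
  have [k [Kk kpi ki]] := fiber_moves (finsec_fam f i) fi.
  by exists k => //; split=> //=; rewrite -pij.
Qed.

End InvariantSections.
End EquivariantFamily.

(** * The cover of a representation of a fair group *)

Section CentralProducts.
Local Open Scope group_scope.
Variables (G : topologicalGroupType) (C : set G).
Hypotheses (subC : is_subgroup C) (centralC : is_central C).
Implicit Types (H K A : set G) (g h k : G).

Lemma mul_set_central_subgroup H : is_subgroup H -> is_subgroup (mul_set H C).
Proof.
move=> sH; apply: is_subgroupP.
  exists 1; first exact: subgroup1.
  by exists 1; [exact: subgroup1 | rewrite mulg1].
move=> _ _ [h Hh [c Cc <-]] [h' Hh' [c' Cc' <-]].
exists (h * h'^-1); first by apply: subgroupM => //; apply: subgroupV.
have Ccc' : C (c * c'^-1) by apply: subgroupM => //; apply: subgroupV.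
exists (c * c'^-1) => //.
by rewrite invMg -!mulgA (mulgA c) -(centralC h'^-1 Ccc').
Qed.

Lemma conj_setP g A x : conj_set g A x <-> A (g^-1 * x * g).
Proof.
split=> [[y Ay <-]|Ax]; first by rewrite !mulgA mulVg mul1g mulgVK.
by exists (g^-1 * x * g); rewrite // !mulgA mulgV mul1g mulgK.
Qed.

Lemma mul_setA A H K : mul_set (mul_set A H) K = mul_set A (mul_set H K).
Proof.
apply/seteqP; split.
  move=> _ [_ [a Aa [h Hh <-]] [k Kk <-]]; exists a => //.
  by exists (h * k); [exists h => //; exists k | rewrite mulgA].
move=> _ [a Aa [_ [h Hh [k Kk <-]] <-]].
exists (a * h); first by exists a => //; exists h.
by exists k; rewrite ?mulgA.
Qed.

Lemma mul_set_absorb H K : is_subgroup K -> H 1 -> H `<=` K -> mul_set H K = K.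
Proof.
move=> sK H1 HK; apply/seteqP; split=> [_ [h Hh [k Kk <-]]|k Kk].
  by apply: subgroupM => //; apply: HK.
by exists 1 => //; exists k; rewrite ?mul1g.
Qed.

(** Fairness only places [H'] inside [K]; intersecting it with [H] preserves strictness, as the
    element witnessing it stays outside the smaller set. *)
Lemma fair_shrink K : is_subgroup K -> fair C K ->
  exists shrink : set G -> set G,
  forall H, is_subgroup H -> open H -> H `<=` K ->
  [/\ is_subgroup (shrink H), open (shrink H), shrink H `<=` H
    & forall g, exists k, [/\ K k, mul_set H C (g^-1 * k * g)
      & ~ mul_set (shrink H) C (g^-1 * k * g)]].
Proof.
move=> sK fairK.
suff /choice[s sP] : forall H, exists H', is_subgroup H -> open H -> H `<=` K ->
  [/\ is_subgroup H', open H', H' `<=` H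
    & forall g, exists k, [/\ K k, mul_set H C (g^-1 * k * g)
      & ~ mul_set H' C (g^-1 * k * g)]] by exists s.
move=> H.
have [[sH oH HK]|nH] := pselect [/\ is_subgroup H, open H & H `<=` K];
  last first.
  (* An arbitrary value when [H] is not an open subgroup of [K]. *)
  by exists setT => *; case: nH.
have [H' [sH' oH' H'K H'H]] := fairK H sH oH HK.
exists (H' `&` H) => _ _ _.
split; [exact: subgroupI|exact: openI|exact: subIsetr|].
move=> g; have [_ /nonsubset[k [[Kk /conj_setP Hk] nH'k]]] := H'H g.
exists k; split => // -[h [H'h _] [c Cc hc]]; apply: nH'k; split=> //.
by apply/conj_setP; exists h => //; exists c.
Qed.

End CentralProducts.

(** * The family of fixed vectors indexed by cosets *)

Section CosetFamily.
Variables (p : nat) (F : fieldType) (G : topologicalGroupType) (C K : set G).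
Variables (chi : G -> F) (P : smooth_rep C chi) (shrink : set G -> set G).
Hypotheses (charF : p \in [pchar F]) (oK : open K) (ppK : pro_p p K).
Hypotheses (subC : is_subgroup C) (centralC : is_central C).
Hypothesis shrinkP : forall H, is_subgroup H -> open H -> H `<=` K ->
  [/\ is_subgroup (shrink H), open (shrink H), shrink H `<=` H
    & forall g, exists k, [/\ K k, mul_set H C (g^-1 * k * g)%g
      & ~ mul_set (shrink H) C (g^-1 * k * g)%g]].

Let sK : is_subgroup K. Proof. by case: ppK => -[]. Qed.

Definition coset_act g (i : set G * set G) := (i.1, mul_set [set g] i.2).

(* The index set is the disjoint union over H of the G-sets G/H'C, where a coset
   is represented by a subset of G; at any other index only 0 is allowed. *)
Definition coset_fam (i : set G * set G) : set P := [set u | u != 0 ->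
  [/\ [/\ is_subgroup i.1, open i.1 & i.1 `<=` K],
      exists g, i.2 = mul_set [set g] (mul_set (shrink i.1) C)
    & forall g h, i.2 g -> i.1 h -> rep_act P (g * h * g^-1)%g u = u]].

Lemma coset_act1 i : coset_act 1%g i = i.
Proof. by case: i => H A; rewrite /coset_act mul_set11. Qed.

Lemma coset_actM g h i : coset_act (g * h)%g i = coset_act g (coset_act h i).
Proof. by rewrite /coset_act /= mul_set1M. Qed.

Lemma coset_fam0 i : coset_fam i 0.
Proof. by rewrite /coset_fam /= eqxx. Qed.

Lemma coset_fam_linear i a u v :
  coset_fam i u -> coset_fam i v -> coset_fam i (a *: u + v).
Proof.
move=> Wu Wv; have [->|u0] := eqVneq u 0; first by rewrite scaler0 add0r.
have [Hi Ai iu] := Wu u0 => _; split=> // g h Ag Hh.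
rewrite linearP /= iu //; congr (_ + _).
have [->|v0] := eqVneq v 0; first exact: linear0.
by have [_ _] := Wv v0; apply.
Qed.

Lemma coset_fam_equivariant g i u :
  coset_fam i u -> coset_fam (coset_act g i) (rep_act P g u).
Proof.
case: i => H A Wu gu0.
have u0 : u != 0 by apply: contra_neq gu0 => ->; exact: linear0.
have [Hi [k /= Ak] iu] := Wu u0; split=> //=.
  by exists (g * k)%g; rewrite Ak mul_set1M.
(* Conjugating [h] by [x] amounts to conjugating it by [g^-1 * x], which lies in [A], and then by
   [g]. *)
move=> x h /mul_set1P Ax Hh; have {}iu := iu _ _ Ax Hh.
rewrite -{2}iu -!rep_actM; congr (rep_act P _ u).
by rewrite invMg invgK !mulgA mulgV mul1g.
Qed.

(** The conjugate by [g] of the open subgroup [shrink H] fixes the coset of [g]. *)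
Lemma coset_fam_stab i u : coset_fam i u -> u != 0 ->
  nbhs 1%g [set g | coset_act g i = i].
Proof.
case: i => H A Wu u0; have [[/= sH oH HK] [g /= ->] _] := Wu u0.
have [sH' oH' _ _] := shrinkP sH oH HK.
have := open_nbhs_nbhs (conj (open_mul2 g^-1%g g oH') _ : open_nbhs 1%g _).
rewrite /= mulg1 mulVg => /(_ (subgroup1 sH')); apply: filterS => k /= H'k.
rewrite /coset_act /= -mul_set1M; congr (_, _).
apply: eq_mul_set1; first exact: mul_set_central_subgroup.
apply/mul_set1P; exists (g^-1 * k * g)%g => //.
by exists 1%g; rewrite ?mulg1 ?mulgA //; apply: subgroup1.
Qed.

Lemma coset_fam_central i u c : coset_fam i u -> u != 0 -> C c ->
  coset_act c i = i.
Proof.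
case: i => H A Wu u0 Cc; have [[/= sH oH HK] [g /= ->] _] := Wu u0.
have [sH' _ _ _] := shrinkP sH oH HK.
rewrite /coset_act /= -mul_set1M; congr (_, _).
apply: eq_mul_set1; first exact: mul_set_central_subgroup.
apply/mul_set1P; exists 1%g; first exact: subgroup1.
by exists c; rewrite // mul1g (centralC g Cc) mulKg.
Qed.

Definition coset_family : equivariant_family P (set G * set G)%type :=
  EquivariantFamily coset_act1 coset_actM coset_fam0 coset_fam_linear
    coset_fam_equivariant coset_fam_stab coset_fam_central.

Lemma finsec_sum_surjective v : exists f, finsec_sum (W := coset_family) f = v.
Proof.
pose H := K `&` rep_stab v.
have sH : is_subgroup H by exact: subgroupI sK (rep_stab_subgroup v).
have oH : open H by exact: openI oK (rep_smooth v).
have HK : H `<=` K by exact: subIsetl.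
have [sH' _ H'H _] := shrinkP sH oH HK.
apply: (@finsec_dirac _ _ _ _ _ _ coset_family (H, mul_set (shrink H) C)).
move=> _; split=> //=; first by exists 1%g; rewrite mul_set11.
move=> _ h [h' H'h' [c Cc <-]] Hh.
(* The fixing condition is needed for every representative of the base coset: the central factor [c]
   cancels, and conjugation by [h'] preserves [H] because [shrink H] lies in [H]. *)
suff [] : H (h' * c * h * (h' * c)^-1)%g by [].
have -> : (h' * c * h * (h' * c)^-1 = h' * h * h'^-1)%g.
  by rewrite invMg -(mulgA h') (centralC h Cc) !mulgA mulgK.
have Hh' := H'H _ H'h'.
by apply: subgroupM => //; [exact: subgroupM | exact: subgroupV].
Qed.

(** The projection of [G/H'C] onto [G/HC], written as a right multiplication so that it is defined
    and equivariant on all pairs of subsets. *)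
Let pi (i : set G * set G) := (i.1, mul_set i.2 (mul_set i.1 C)).

Lemma finsec_sum_invariant0 (f : finsec coset_family) :
  (forall k, K k -> finsec_act k f = f) -> finsec_sum f = 0.
Proof.
have piE H g : is_subgroup H -> is_subgroup (shrink H) -> shrink H `<=` H ->
    pi (H, mul_set [set g] (mul_set (shrink H) C)) =
    (H, mul_set [set g] (mul_set H C)).
  move=> sH sH' H'H.
  rewrite /pi /= mul_setA (mul_set_absorb (K := mul_set H C)) //.
  - exact: mul_set_central_subgroup.
  - by apply: subgroup1; apply: mul_set_central_subgroup.
  - by move=> _ [h /H'H Hh [c Cc <-]]; exists h => //; exists c.
apply: (finsec_sum_invariant (pi := pi) charF oK ppK).
- by move=> g [H A]; rewrite /pi /= /coset_act /= mul_setA.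
- move=> [H A] u k Wu u0 Kk; have [[/= sH oH HK] [g /= ->] gHu] := Wu u0.
  have [sH' _ H'H _] := shrinkP sH oH HK.
  have sHC := mul_set_central_subgroup subC centralC sH.
  rewrite piE // /coset_act /= -mul_set1M => -[kgHC].
  have := mul_set1_refl (k * g)%g sHC.
  rewrite kgHC => /mul_set1P[h Hh [c Cc hc]].
  (* An element stabilizing [gHC] is a conjugate of some [h] in [H], which fixes [u], times some [c]
     in [C], which acts by a scalar; that scalar is [1] because [k] lies in [K]. *)
  have ku : rep_act P k u = chi c *: u.
    have -> : k = (g * h * g^-1 * c)%g.
      rewrite -mulgA -(centralC g^-1%g Cc) mulgA -(mulgA g) hc.
      by rewrite mulVKg mulgK.
    rewrite rep_actM (rep_central _ Cc) linearZ /= gHu //.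
    by apply: mul_set1_refl; apply: mul_set_central_subgroup.
  by rewrite ku (rep_eigenvalue1 charF oK ppK u0 Kk ku) scale1r.
- move=> [H A] u Wu u0; have [[/= sH oH HK] [g /= ->] _] := Wu u0.
  (* Fairness at [g] yields [k] in [K] that stabilizes [gHC] but moves [gH'C]. *)
  have [sH' _ H'H /(_ g)[k [Kk HCk nH'k]]] := shrinkP sH oH HK.
  exists k; split=> //.
    rewrite piE // /coset_act /= -mul_set1M; congr (_, _).
    apply: eq_mul_set1; first exact: mul_set_central_subgroup.
    by apply/mul_set1P; rewrite mulgA.
  rewrite /coset_act /= -mul_set1M => -[kg]; apply: nH'k.
  have := mul_set1_refl (k * g)%g (mul_set_central_subgroup subC centralC sH').
  by rewrite kg => /mul_set1P; rewrite mulgA.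
Qed.

End CosetFamily.

Theorem theorem4p4 (p : nat) (F : fieldType) (G : topologicalGroupType)
    (C : set G)
    (charF : p \in [pchar F])
    (locG : locally_pro_p G p)
    (subC : is_subgroup C) (closedC : closed C) (centralC : is_central C)
    (fairG : exists K : set G, [/\ open K, pro_p p K & fair C K])
    (chi : G -> F) (charC : continuous_character C chi) :
  ~ exists P : smooth_rep C chi, projective P /\ exists v : P, v <> 0.
Proof.
move=> [P [projP exv]]; have [K [oK ppK fairK]] := fairG.
have sK : is_subgroup K by case: ppK => -[].
have [w w0 wK] := exists_fixed_vector charF oK ppK exv.
have [shrink shrinkP] := fair_shrink sK fairK.
pose W := coset_family P subC centralC shrinkP.
pose idP : rep_hom P P := @RepHom F G C chi P P idfun (fun _ _ => erefl).
(* Lifting the identity of [P] gives a section [s]; the sum map is an epimorphism because it is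
   surjective. *)
have [|s sK1] := projP _ _ (finsec_sum_hom W) idP.
  move=> Z u v uv x.
  have [f <-] := finsec_sum_surjective oK ppK subC centralC shrinkP x.
  exact: uv.
have := sK1 w; rewrite /= => sw.
(* By equivariance [s w] is [K]-invariant like [w], so its sum, which is [w], vanishes. *)
move: w0; rewrite -sw (finsec_sum_invariant0 charF oK ppK) ?eqxx //.
by move=> k Kk; rewrite -[finsec_act _ _](rep_equivariant s k w) wK.
Qed.
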